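(* Let $M$ be a smooth connected manifold with a linear connection $\nabla$ (a connection on $TM$) with torsion $T$ and curvature $\mathfrak{R}$. For every $p$-form $\Theta\in\bigwedge^p(M)$ and every vector field $Z\in\mathfrak{X}(M)$, $$d\omega_{\Theta,Z}=\mathfrak{R}_{\Theta,Z}-\Psi_{\Theta,Z}+T_{\Theta,Z},$$ where the $p$-form $\omega_{\Theta,Z}$ and the $(p+1)$-forms $\mathfrak{R}_{\Theta,Z},\Psi_{\Theta,Z},T_{\Theta,Z}$ are defined on vector fields by $$\omega_{\Theta,Z}(X_1,\dots,X_p)=\sum_{1\le i\le p}(-1)^{i+1}\Theta(\nabla_{X_i}Z,X_1,\dots,\bar X_i,\dots,X_p),$$ $$\mathfrak{R}_{\Theta,Z}(X_1,\dots,X_{p+1})=\sum_{1\le i<j\le p+1}(-1)^{i+j+1}\Theta(\mathfrak{R}(X_i,X_j)Z,X_1,\dots,\bar X_i,\dots,\bar X_j,\dots,X_{p+1}),$$ $$\Psi_{\Theta,Z}(X_1,\dots,X_{p+1})=\sum_{1\le i<j\le p+1}(-1)^{i+j}\Big((\nabla_{X_i}\Theta)(\nabla_{X_j}Z,X_1,\dots,\bar X_i,\dots,\bar X_j,\dots,X_{p+1})-(\nabla_{X_j}\Theta)(\nabla_{X_i}Z,X_1,\dots,\bar X_i,\dots,\bar X_j,\dots,X_{p+1})\Big),$$ $$T_{\Theta,Z}(X_1,\dots,X_{p+1})=\sum_{1\le i<j<k\le p+1}(-1)^{i+j+k}\Big(\Theta(T(X_i,X_j),\nabla_{X_k}Z,\dots)+\Theta(T(X_j,X_k),\nabla_{X_i}Z,\dots)+\Theta(T(X_k,X_i),\nabla_{X_j}Z,\dots)\Big),$$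 where in the last formula the dots stand for $X_1,\dots,X_{p+1}$ in increasing order with $X_i,X_j,X_k$ omitted (so $T_{\Theta,Z}=0$ if $p=1$).
   Context: $\mathfrak{X}(M)$ denotes smooth vector fields and $\bigwedge^p(M)$ smooth $p$-forms on $M$. A bar over an argument means it is omitted; empty sums are zero. Torsion and curvature: $T(X,Y)=\nabla_XY-\nabla_YX-[X,Y]$, $\mathfrak{R}(X,Y)Z=\nabla_X\nabla_YZ-\nabla_Y\nabla_XZ-\nabla_{[X,Y]}Z$. The connection acts on forms as usual by $(\nabla_X\Theta)(Y_1,\dots,Y_p)=X(\Theta(Y_1,\dots,Y_p))-\sum_i\Theta(Y_1,\dots,\nabla_XY_i,\dots,Y_p)$. The exterior derivative of a $p$-form $\omega$ is normalized by $$d\omega(X_1,\dots,X_{p+1})=\sum_i(-1)^{i+1}X_i(\omega(X_1,\dots,\bar X_i,\dots,X_{p+1}))+\sum_{i<j}(-1)^{i+j}\omega([X_i,X_j],X_1,\dots,\bar X_i,\dots,\bar X_j,\dots,X_{p+1}).$$ *)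

(* Defs.v *)
From HB Require Import structures.
From mathcomp Require Import all_boot all_order all_algebra.
From mathcomp Require Import boolp classical_sets functions cardinality reals.
From mathcomp Require Import topology normedtype derive.
From mathcomp Require Import ring.

Set Implicit Arguments.
Unset Strict Implicit.
Unset Printing Implicit Defensive.

Import Order.TTheory GRing.Theory Num.Theory.
Import numFieldNormedType.Exports.

Local Open Scope classical_set_scope.
Local Open Scope ring_scope.

Section SmoothEuclidean.
Context {R : realType} {n : nat}.
Implicit Types (U : set 'rV[R]_n) (f g : 'rV[R]_n -> R).

(* U is meant to be open, so that the values of f outside U are irrelevant. *)
Fixpoint Ck_on (k : nat) U f : Prop :=
  (forall x, U x -> {for x, continuous f}) /\
  if k is k'.+1 then
    forall i : 'I_n,
      (forall x, U x -> derivable f x (delta_mx 0 i)) /\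
      Ck_on k' U (fun x => 'D_(delta_mx 0 i) f x)
  else True.

Definition smooth_on U f : Prop := forall k, Ck_on k U f.

Lemma eq_continuous_at U f g x : open U -> {in U, f =1 g} -> U x ->
  {for x, continuous f} -> {for x, continuous g}.
Proof.
move=> oU fg Ux cf; have nfg : \near x, f x = g x.
  by apply: filterS (open_nbhs_nbhs (conj oU Ux)) => y Uy; apply/fg/mem_set.
rewrite /prop_for /continuous_at -(fg x (mem_set Ux)).
apply: cvg_trans cf; exact: (@near_eq_cvg _ _ (nbhs x) _ _ _ nfg).
Qed.

Lemma eq_Ck_on k U f g : open U -> {in U, f =1 g} -> Ck_on k U f -> Ck_on k U g.
Proof.
move=> oU; elim: k f g => [|k IH] f g fg /= [cf df]; split=> //.
1,2: by move=> x Ux; apply: (eq_continuous_at oU fg Ux); exact: cf.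
have nfg x : U x -> \near x, f x = g x.
  move=> Ux; apply: filterS (open_nbhs_nbhs (conj oU Ux)) => y Uy.
  exact/fg/mem_set.
move=> i; have [dfi Cf] := df i; split.
  by move=> x Ux; apply: near_eq_derivable (dfi x Ux); exact: nfg.
by apply: IH Cf => x /set_mem Ux; apply: near_eq_derive; exact: nfg.
Qed.

Lemma Ck_onW k U f : Ck_on k.+1 U f -> Ck_on k U f.
Proof.
elim: k f => [|k IH] f /= [cf df]; split=> //.
by move=> i; have [dfi Cf] := df i; split=> //; exact: IH.
Qed.

Lemma Ck_on_cst k U (a : R) : Ck_on k U (cst a).
Proof.
elim: k a => [|k IH] a /=; split => //.
1,2: by move=> x _; exact: cst_continuous.
move=> i; split=> [x _|]; first exact: derivable_cst.
suff -> : (fun x : 'rV[R]_n => 'D_(delta_mx 0 i) (cst a) x) = cst 0 by exact: IH.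
by apply/funext => x; rewrite derive_cst.
Qed.

Lemma Ck_onD k U f g : open U ->
  Ck_on k U f -> Ck_on k U g -> Ck_on k U (fun x => f x + g x).
Proof.
move=> oU; elim: k f g => [|k IH] f g /= [cf df] [cg dg]; split=> //.
1,2: by move=> x Ux; exact: (continuousD (cf x Ux) (cg x Ux)).
move=> i; have [dfi Cf] := df i; have [dgi Cg] := dg i; split.
  by move=> x Ux; apply: derivableD; [exact: dfi|exact: dgi].
apply: eq_Ck_on (IH _ _ Cf Cg) => // x /set_mem Ux.
by rewrite -deriveD; [|exact: dfi|exact: dgi].
Qed.

Lemma Ck_onM k U f g : open U ->
  Ck_on k U f -> Ck_on k U g -> Ck_on k U (fun x => f x * g x).
Proof.
move=> oU; elim: k f g => [|k IH] f g Kf Kg; split=> //.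
1,2: by move=> x Ux; exact: (continuousM (Kf.1 x Ux) (Kg.1 x Ux)).
move=> i; have [dfi Cf] := Kf.2 i; have [dgi Cg] := Kg.2 i; split.
  by move=> x Ux; apply: derivableM; [exact: dfi|exact: dgi].
apply: (@eq_Ck_on _ _ (fun x => f x * 'D_(delta_mx 0 i) g x +
                                g x * 'D_(delta_mx 0 i) f x)) => //.
  by move=> x /set_mem Ux; rewrite (deriveM (dfi x Ux) (dgi x Ux)).
by apply: Ck_onD => //; apply: IH => //; exact: Ck_onW.
Qed.

End SmoothEuclidean.

(* The maps are total, with irrelevant values outside the chart domain and
   the chart codomain. *)
Record chart (R : realType) (n : nat) (M : topologicalType) := Chart {
  chart_dom : set M;
  chart_cod : set 'rV[R]_n;
  chart_map : M -> 'rV[R]_n;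
  chart_inv : 'rV[R]_n -> M;
  chart_dom_open : open chart_dom;
  chart_cod_open : open chart_cod;
  chart_mapP : forall x, chart_dom x -> chart_cod (chart_map x);
  chart_invP : forall y, chart_cod y -> chart_dom (chart_inv y);
  chart_mapK : forall x, chart_dom x -> chart_inv (chart_map x) = x;
  chart_invK : forall y, chart_cod y -> chart_map (chart_inv y) = y;
  chart_map_continuous : forall x, chart_dom x -> {for x, continuous chart_map};
  chart_inv_continuous : forall y, chart_cod y -> {for y, continuous chart_inv}
}.

Definition smoothly_compatible (R : realType) (n : nat) (M : topologicalType)
    (c e : chart R n M) : Prop :=
  forall j : 'I_n,
    smooth_on (chart_cod c `&` chart_inv c @^-1` chart_dom e)
              (fun y => chart_map e (chart_inv c y) 0 j).

(* The atlas need not be maximal: it determines the smooth structure. *)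
Record manifold (R : realType) (n : nat) := Manifold {
  manifold_space :> topologicalType;
  manifold_hausdorff : hausdorff_space manifold_space;
  manifold_second_countable : @second_countable manifold_space;
  atlas : set (chart R n manifold_space);
  atlas_cover : forall x, exists2 c, atlas c & chart_dom c x;
  atlas_compatible : forall c e, atlas c -> atlas e -> smoothly_compatible c e
}.

Section SmoothFunctions.
Context {R : realType} {n : nat} (M : manifold R n).

Definition is_smooth (f : M -> R) : Prop :=
  forall c, atlas c -> smooth_on (chart_cod c) (f \o chart_inv c).

Definition smooth_pred : {pred M -> R} := fun f => `[< is_smooth f >].

Lemma is_smooth_cst (a : R) : is_smooth (cst a).
Proof. by move=> c _ k; exact: Ck_on_cst. Qed.

Lemma is_smoothD (f g : M -> R) :
  is_smooth f -> is_smooth g -> is_smooth (f + g).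
Proof.
move=> sf sg c ac k.
exact: (Ck_onD (@chart_cod_open _ _ _ c) (sf c ac k) (sg c ac k)).
Qed.

Lemma is_smoothM (f g : M -> R) :
  is_smooth f -> is_smooth g -> is_smooth (f * g).
Proof.
move=> sf sg c ac k.
exact: (Ck_onM (@chart_cod_open _ _ _ c) (sf c ac k) (sg c ac k)).
Qed.

Lemma smooth_subring_closed : subring_closed smooth_pred.
Proof.
split=> [|f g /asboolP sf /asboolP sg|f g /asboolP sf /asboolP sg];
  apply/asboolP.
- exact: is_smooth_cst.
- apply: is_smoothD => //.
  have -> : - g = cst (- 1) * g by rewrite -[LHS]mulN1r.
  by apply: is_smoothM => //; exact: is_smooth_cst.
- exact: is_smoothM.
Qed.

HB.instance Definition _ :=
  GRing.isSubringClosed.Build _ smooth_pred smooth_subring_closed.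

Record smooth_fun := SmoothFun {
  smooth_fun_val :> M -> R;
  smooth_funP : smooth_fun_val \in smooth_pred
}.

HB.instance Definition _ := [isSub for smooth_fun_val].
HB.instance Definition _ := [Choice of smooth_fun by <:].
HB.instance Definition _ :=
  GRing.SubChoice_isSubComPzRing.Build _ _ smooth_fun smooth_subring_closed.

Definition smooth_cst (a : R) : smooth_fun :=
  SmoothFun (asboolT (is_smooth_cst a)).

End SmoothFunctions.

(* A smooth vector field is a derivation of the R-algebra C of smooth functions;
   smooth_cst embeds R into C. The regular module C^o is used so that vector
   fields form a module over C. *)

Section VectorFields.
Context {R : realType} {n : nat} (M : manifold R n).
Local Notation C := (smooth_fun M).

Definition is_derivation (X : C -> C) : Prop :=
  [/\ forall (a : R) f, X (smooth_cst M a * f) = smooth_cst M a * X f,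
      forall f g, X (f + g) = X f + X g
    & forall f g, X (f * g) = X f * g + f * X g].

Definition derivation_pred : {pred C -> C^o} := fun X => `[< is_derivation X >].

Lemma derivation_submod_closed : subsemimod_closed derivation_pred.
Proof.
split; first split.
- apply/asboolP; split=> [a f|f g|f g].
  + by rewrite [LHS]/= mulr0.
  + by rewrite [LHS]/= addr0.
  + by rewrite [LHS]/= mul0r mulr0 addr0.
- move=> X Y /asboolP[X1 X2 X3] /asboolP[Y1 Y2 Y3]; apply/asboolP.
  split=> [a f|f g|f g]; rewrite !addrfctE.
  + by rewrite X1 Y1 mulrDr.
  + by rewrite X2 Y2 addrACA.
  + by rewrite X3 Y3 mulrDl mulrDr addrACA.
- move=> h X /asboolP[X1 X2 X3]; apply/asboolP.
  have E f : (h *: X) f = h * X f by [].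
  split=> [a f|f g|f g]; rewrite !E.
  + by rewrite X1 mulrCA.
  + by rewrite X2 mulrDr.
  + by rewrite X3 mulrDr mulrA (mulrCA h).
Qed.

HB.instance Definition _ := GRing.isSubmodClosed.Build _ _ derivation_pred
  derivation_submod_closed.

Record vector_field := VectorField {
  vector_field_val :> C -> C^o;
  vector_fieldP : vector_field_val \in derivation_pred
}.

HB.instance Definition _ := [isSub for vector_field_val].
HB.instance Definition _ := [Choice of vector_field by <:].
HB.instance Definition _ :=
  GRing.SubChoice_isSubLmodule.Build _ _ _ vector_field derivation_submod_closed.

Lemma lie_bracket_subproof (X Y : vector_field) :
  (fun f => X (Y f) - Y (X f) : C^o) \in derivation_pred.
Proof.
have /asboolP[X1 X2 X3] := vector_fieldP X.
have /asboolP[Y1 Y2 Y3] := vector_fieldP Y.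
apply/asboolP; split=> [a f|f g|f g].
- by rewrite Y1 X1 X1 Y1 mulrBr.
- by rewrite Y2 X2 X2 Y2 opprD addrACA.
- by rewrite Y3 X2 !X3 Y2 !Y3; ring.
Qed.

Definition lie_bracket (X Y : vector_field) : vector_field :=
  VectorField (lie_bracket_subproof X Y).

End VectorFields.

Section Connections.
Context {R : realType} {n : nat} {M : manifold R n}.
Local Notation V := (vector_field M).

Record connection := Connection {
  nabla :> V -> V -> V;
  nabla_linearl : forall (f : smooth_fun M) (X X' Y : V),
    nabla (f *: X + X') Y = f *: nabla X Y + nabla X' Y;
  nabla_additiver : forall X Y Y' : V,
    nabla X (Y + Y') = nabla X Y + nabla X Y';
  nabla_leibniz : forall (f : smooth_fun M) (X Y : V),
    nabla X (f *: Y) = (X f : smooth_fun M) *: Y + f *: nabla X Y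
}.

Variable D : connection.

Definition torsion (X Y : V) : V := D X Y - D Y X - lie_bracket X Y.

Definition curvature (X Y Z : V) : V :=
  D X (D Y Z) - D Y (D X Z) - D (lie_bracket X Y) Z.

End Connections.

Arguments connection {R n} M.

(* A smooth p-form is an alternating map on p-tuples of vector fields which is
   multilinear over the ring of smooth functions; a p-tuple (X_1, ..., X_p) of
   vector fields is a map X on 'I_p, whose index i stands for i.+1. *)

Section Forms.
Context {R : realType} {n : nat} {M : manifold R n}.
Local Notation C := (smooth_fun M).
Local Notation V := (vector_field M).

Definition is_diff_form (p : nat) (w : ('I_p -> V) -> C) : Prop :=
  (forall (X : 'I_p -> V) (i : 'I_p) (f : C) (Y Y' : V),
     w [eta X with i |-> f *: Y + Y'] =
     f * w [eta X with i |-> Y] + w [eta X with i |-> Y']) /\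
  (forall (X : 'I_p -> V) (i j : 'I_p), i != j -> X i = X j -> w X = 0).

Record diff_form (p : nat) := DiffForm {
  diff_form_val :> ('I_p -> V) -> C;
  diff_formP : is_diff_form diff_form_val
}.

(* The value of w on the vector fields listed in s; it is only used for lists
   of length p. *)
Definition at_seq (p : nat) (w : ('I_p -> V) -> C) (s : seq V) : C :=
  w (fun k => s`_k).

(* The list X_1, ..., X_q with the entries whose index is in I omitted. *)
Definition omit (q : nat) (X : 'I_q -> V) (I : seq 'I_q) : seq V :=
  [seq X k | k <- enum 'I_q & k \notin I].

Definition ext_d (p : nat) (w : ('I_p -> V) -> C) (X : 'I_p.+1 -> V) : C :=
  \sum_(i < p.+1)
    (-1) ^+ (i.+1 + 1) * (X i (at_seq w (omit X [:: i])) : C) +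
  \sum_(i < p.+1) \sum_(j < p.+1 | (i < j)%N)
    (-1) ^+ (i.+1 + j.+1) *
    at_seq w (lie_bracket (X i) (X j) :: omit X [:: i; j]).

Variable D : connection M.

Definition nabla_form (p : nat) (X : V) (w : ('I_p -> V) -> C)
    (Y : 'I_p -> V) : C :=
  (X (w Y) : C) - \sum_(i < p) w [eta Y with i |-> D X (Y i)].

Variables (p : nat) (Theta : diff_form p) (Z : V).

Definition omega (X : 'I_p -> V) : C :=
  \sum_(i < p)
    (-1) ^+ (i.+1 + 1) * at_seq Theta (D (X i) Z :: omit X [:: i]).

Definition curvature_form (X : 'I_p.+1 -> V) : C :=
  \sum_(i < p.+1) \sum_(j < p.+1 | (i < j)%N)
    (-1) ^+ (i.+1 + j.+1 + 1) *
    at_seq Theta (curvature D (X i) (X j) Z :: omit X [:: i; j]).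

Definition Psi_form (X : 'I_p.+1 -> V) : C :=
  \sum_(i < p.+1) \sum_(j < p.+1 | (i < j)%N)
    (-1) ^+ (i.+1 + j.+1) *
    (at_seq (nabla_form (X i) Theta) (D (X j) Z :: omit X [:: i; j]) -
     at_seq (nabla_form (X j) Theta) (D (X i) Z :: omit X [:: i; j])).

Definition torsion_form (X : 'I_p.+1 -> V) : C :=
  \sum_(i < p.+1) \sum_(j < p.+1 | (i < j)%N) \sum_(k < p.+1 | (j < k)%N)
    (-1) ^+ (i.+1 + j.+1 + k.+1) *
    let T_ab_c (a b c : 'I_p.+1) :=
      at_seq Theta
        [:: torsion D (X a) (X b), D (X c) Z & omit X [:: i; j; k]] in
    (T_ab_c i j k + T_ab_c j k i + T_ab_c k i j).

End Forms.

Arguments diff_form {R n} M p.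

(* Main.v *)
Require Import Defs.
From HB Require Import structures.
From mathcomp Require Import all_boot all_order all_algebra.
From mathcomp Require Import boolp classical_sets functions cardinality reals.
From mathcomp Require Import topology normedtype derive.
From mathcomp Require Import zify ring.

(* Every form of the statement is a signed sum, over the ways of pulling one,
   two or three entries out of the list X_1, ..., X_q, of an expression in the
   pulled entries and the remaining list.  Such sums are written by recursion on
   the list (according to whether its head is pulled out or not), which makes
   them easy to compare: pulling out one entry and then another one is pulling
   out a pair and antisymmetrizing.

   With A Y = D_Y Z, the Leibniz rule for D_X turns X (omega (...)) into terms
   (D_X Theta)(A Y, ...), which give Psi, terms Theta (D_X (A Y), ...), which
   together with Theta (A [X, Y], ...) give the curvature, and terms where D_X
   hits another argument W.  Pulling W out and antisymmetrizing in X and W, the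
   latter combine with the remaining terms containing [X, W] into
   Theta (T (X, W), A Y, ...). *)

Set Implicit Arguments.
Unset Strict Implicit.
Unset Printing Implicit Defensive.
Import GRing.Theory.

Local Open Scope classical_set_scope.
Local Open Scope ring_scope.

(** * Signed sums over the entries pulled out of a list *)

Section AlternatingSums.
Variables (T : Type) (C : comPzRingType).
Implicit Types (x y : T) (s t : seq T).

(* alt1, alt2 and alt3 pull out one, two and three entries; x :: t puts the
   head x back among the entries that are not pulled out.  The sign is + when
   the pulled entries come first; skipping the head raises all k pulled indices
   by one, whence the factor (-1)^k of the recursive call. *)
Fixpoint alt1 (G : T -> seq T -> C) s : C :=
  if s is x :: s' then G x s' - alt1 (fun y t => G y (x :: t)) s' else 0.

Fixpoint alt2 (G : T -> T -> seq T -> C) s : C :=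
  if s is x :: s' then alt1 (G x) s' + alt2 (fun y z t => G y z (x :: t)) s'
  else 0.

Fixpoint alt3 (G : T -> T -> T -> seq T -> C) s : C :=
  if s is x :: s' then
    alt2 (G x) s' - alt3 (fun y z w t => G y z w (x :: t)) s'
  else 0.

Lemma eq_alt1 G G' s :
    (forall x t, (size t).+1 = size s -> G x t = G' x t) ->
  alt1 G s = alt1 G' s.
Proof.
elim: s G G' => //= x s IH G G' E; congr (_ - _); first exact: E.
by apply: IH => y t st; apply: E; rewrite /= st.
Qed.

Lemma eq_alt2 G G' s :
    (forall x y t, (size t).+2 = size s -> G x y t = G' x y t) ->
  alt2 G s = alt2 G' s.
Proof.
elim: s G G' => //= x s IH G G' E; congr (_ + _).
  by apply: eq_alt1 => y t st; apply: E; rewrite st.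
by apply: IH => y z t st; apply: E; rewrite /= st.
Qed.

Lemma alt1D G G' s :
  alt1 (fun x t => G x t + G' x t) s = alt1 G s + alt1 G' s.
Proof. by elim: s G G' => [|x s IH] G G' /=; rewrite ?IH; ring. Qed.

Lemma alt1Z c G s : alt1 (fun x t => c * G x t) s = c * alt1 G s.
Proof. by elim: s G => [|x s IH] G /=; rewrite ?IH; ring. Qed.

Lemma alt1N G s : alt1 (fun x t => - G x t) s = - alt1 G s.
Proof. by elim: s G => [|x s IH] G /=; rewrite ?IH; ring. Qed.

Lemma alt1_0 G s :
  (forall x t, (size t).+1 = size s -> G x t = 0) -> alt1 G s = 0.
Proof.
move=> G0; rewrite (@eq_alt1 _ (fun x t => 0 * G x t)) ?alt1Z ?mul0r //.
by move=> x t /G0 ->; rewrite mul0r.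
Qed.

Lemma alt2D G G' s :
  alt2 (fun x y t => G x y t + G' x y t) s = alt2 G s + alt2 G' s.
Proof.
by elim: s G G' => [|x s IH] G G' /=; rewrite ?IH ?alt1D; ring.
Qed.

Lemma alt2Z c G s : alt2 (fun x y t => c * G x y t) s = c * alt2 G s.
Proof. by elim: s G => [|x s IH] G /=; rewrite ?IH ?alt1Z; ring. Qed.

Lemma alt2N G s : alt2 (fun x y t => - G x y t) s = - alt2 G s.
Proof. by elim: s G => [|x s IH] G /=; rewrite ?IH ?alt1N; ring. Qed.

Lemma alt2_0 G s :
  (forall x y t, (size t).+2 = size s -> G x y t = 0) -> alt2 G s = 0.
Proof.
move=> G0; rewrite (@eq_alt2 _ (fun x y t => 0 * G x y t)) ?alt2Z ?mul0r //.
by move=> x y t /G0 ->; rewrite mul0r.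
Qed.

(** A pair is reached in two orders, and pulling the later entry first costs one sign. *)
Lemma alt1_alt1 G s :
  alt1 (fun x => alt1 (G x)) s = alt2 (fun x y t => G x y t - G y x t) s.
Proof.
elim: s G => //= x s IH G.
by rewrite alt1D !alt1N IH alt1D alt1N; ring.
Qed.

Lemma alt1_alt1_swap G s :
  alt1 (fun x => alt1 (G x)) s = - alt1 (fun x => alt1 (G^~ x)) s.
Proof.
rewrite !alt1_alt1 -alt2N; apply: eq_alt2 => x y t _.
by rewrite opprB.
Qed.

(** Any of three entries can be the one pulled after the pair; skew-symmetry of [K] in its first two
    arguments turns the middle case, which carries a minus sign, into the missing cyclic term. *)
Lemma alt2_alt1 K s :
    (forall x y z t, (size t).+3 = size s -> K y x z t = - K x y z t) ->
  alt2 (fun x y => alt1 (K x y)) s =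
  alt3 (fun x y z t => K x y z t + K y z x t + K z x y t) s.
Proof.
elim: s K => //= x s IH K Kskew.
rewrite alt2D alt2N IH; last first.
  by move=> y z w t st; rewrite Kskew //= st.
rewrite alt1_alt1 !alt2D alt2N.
rewrite (eq_alt2 (G := fun y z => K z x y) (G' := fun y z t => - K x z y t)).
  by rewrite alt2N; ring.
by move=> y z t st; rewrite Kskew // st.
Qed.

End AlternatingSums.

(** * Alternating forms on lists of vectors *)

Section ListForms.
Variables (C : comPzRingType) (V : lmodType C).
Implicit Types (x y : V) (s t : seq V) (f : C) (F : seq V -> C).

Definition linear_map (h : V -> C) : Prop :=
  forall f x y, h (f *: x + y) = f * h x + h y.

(** Only lists of length [p] are constrained, and repetitions only between neighbours;
    [altform_repeat] covers the others. *)
Definition altform p F : Prop :=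
  (forall s t, (size s + size t).+1 = p ->
    linear_map (fun x => F (s ++ x :: t))) /\
  (forall s t x, (size s + size t).+2 = p -> F (s ++ x :: x :: t) = 0).

Lemma linear_mapB h x y : linear_map h -> h (x - y) = h x - h y.
Proof. by move=> hL; rewrite addrC -scaleN1r hL; ring. Qed.

Lemma linear_mapN h x : linear_map h -> h (- x) = - h x.
Proof.
move=> hL; rewrite -[- x]add0r -[X in h (X - _)](subrr x).
by rewrite !linear_mapB // subrr sub0r.
Qed.

Lemma altform_cons p F x : altform p.+1 F -> altform p (fun s => F (x :: s)).
Proof.
move=> [L A]; split=> [s t st|s t y st].
  by apply: (L (x :: s)); rewrite /= -st.
by apply: (A (x :: s)); rewrite /= -st.
Qed.

Lemma altform_head p F t : altform p.+1 F -> size t = p ->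
  linear_map (fun x => F (x :: t)).
Proof. by move=> [L _] st; apply: (L [::]); rewrite /= st. Qed.

Lemma altform_swap p F s t x y : altform p F -> (size s + size t).+2 = p ->
  F (s ++ y :: x :: t) = - F (s ++ x :: y :: t).
Proof.
move=> [L A] st.
have L1 u : linear_map (fun z => F (s ++ z :: u :: t)).
  by apply: L; rewrite /= addnS.
have L2 u : linear_map (fun z => F (s ++ u :: z :: t)).
  move=> f z w; rewrite -!(cat_rcons u).
  by apply: L; rewrite size_rcons addSn.
(* Polarization: the form vanishes on the repeated vector x + y, written [1 *: x + y] to fit
   [linear_map]; expanding leaves the two mixed terms. *)
have := A s t (1 *: x + y) st.
rewrite L1 !L2 !A //= => E.
by apply/eqP; rewrite -addr_eq0 -[X in _ == X]E; apply/eqP; ring.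
Qed.

(** The first [x] is swapped past the entries of [t] one by one until the two are neighbours. *)
Lemma altform_repeat p F s t r x :
    altform p F -> (size s + size t + size r).+2 = p ->
  F (s ++ x :: t ++ x :: r) = 0.
Proof.
move=> FF; elim: t s => [|y t IH] s st.
  by apply: FF.2; rewrite -st addn0.
rewrite /= (altform_swap _ _ FF); last first.
  by rewrite -st /= size_cat /= !addnS !addSn addnA.
by rewrite -cat_rcons IH ?oppr0 // -st size_rcons /= addSn addnS.
Qed.

Lemma eq_altform p F F' :
  (forall s, size s = p -> F s = F' s) -> altform p F' -> altform p F.
Proof.
move=> E [L A]; split=> [s t st f x y|s t x st].
  by rewrite !E ?L // size_cat /= addnS.
by rewrite !E ?A // size_cat /= !addnS.
Qed.

Lemma altform0 p : altform p (fun=> 0).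
Proof. by split=> // s t _ f x y; ring. Qed.

Lemma altformB p F F' :
  altform p F -> altform p F' -> altform p (fun s => F s - F' s).
Proof.
move=> [L A] [L' A']; split=> [s t st f x y|s t x st].
  by rewrite L ?L' //; ring.
by rewrite A ?A' ?subr0.
Qed.

Lemma alt1_linear (G : V -> V -> seq V -> C) s :
    (forall y t, (size t).+1 = size s -> linear_map (fun x => G x y t)) ->
  linear_map (fun x => alt1 (G x) s).
Proof.
move=> GL f x y; rewrite -alt1Z -alt1D; apply: eq_alt1 => z t st.
exact: GL.
Qed.

(** A varied argument is either pulled out, where [G] is linear in its first argument, or left in
    place, where [G x] is multilinear. Of two equal neighbours, pulling out one or the other gives
    opposite terms, and leaving both gives zero. *)
Lemma altform_alt1 p G : (forall x, altform p (G x)) ->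
    (forall t, size t = p -> linear_map (G^~ t)) ->
  altform p.+1 (alt1 G).
Proof.
move=> GF GL; split=> s t.
- elim: s p G GF GL => [|z s IH] [|p] G GF GL //=.
  + by case: t => // _ f x y /=; rewrite !subr0 GL.
  + move=> [st] f x y; rewrite GL //.
    rewrite (eq_alt1 (G' := fun z r => f * G z (x :: r) + G z (y :: r))).
      by rewrite alt1D alt1Z; ring.
    by move=> z r sr; rewrite (altform_head (GF z)) //; lia.
  + move=> [st] f x y; rewrite (GF z).1 ?st //.
    rewrite (IH p) ?st //; first ring.
      by move=> w; exact: altform_cons.
    by move=> r sr; apply: GL; rewrite /= sr.
- elim: s p G GF GL => [|z s IH] [|p] G GF GL x //=.
  + move=> [st]; rewrite (alt1_0 (G := fun y r => G y (x :: x :: r))).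
      by rewrite subr0 subrr.
    by move=> y r sr; apply: ((GF y).2 [::]); rewrite -st -sr.
  + move=> [/[!addSn] st]; rewrite (GF z).2 ?st // (IH p) ?st ?subrr //.
      by move=> w; exact: altform_cons.
    by move=> r sr; apply: GL; rewrite /= sr.
Qed.

(** As for [alt1], with one more case: both equal neighbours may be pulled out, and then [G]
    vanishes by the diagonal hypothesis. *)
Lemma altform_alt2 p G : (forall x y, altform p (G x y)) ->
    (forall y t, size t = p -> linear_map (fun x => G x y t)) ->
    (forall x t, size t = p -> linear_map (fun y => G x y t)) ->
    (forall x t, size t = p -> G x x t = 0) ->
  altform p.+2 (alt2 G).
Proof.
move=> GF GL1 GL2 GA; split=> s t.
- elim: s p G GF GL1 GL2 GA => [|z s IH] [|p] G GF GL1 GL2 GA //=.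
  + case: t => [|w [|//]] // _ f x y /=; rewrite !subr0 !addr0; exact: GL1.
  + move=> [st] f x y.
    rewrite (alt1_linear (G := G)); last by move=> ? ? st'; apply: GL1; lia.
    rewrite (eq_alt2
      (G' := fun z w r => f * G z w (x :: r) + G z w (y :: r))).
      by rewrite alt2D alt2Z; ring.
    by move=> z w r sr; rewrite (altform_head (GF z w)) //; lia.
  + case: s t IH => [|//] [|//] IH _ f x y /=.
    by rewrite !subr0 !addr0 GL2.
  + move=> [st] f x y; rewrite (altform_alt1 (GF z) (GL2 z)).1 ?st //.
    rewrite (IH p) ?st //; first ring.
    * by move=> w v; exact: altform_cons.
    * by move=> w r sr; apply: GL1; rewrite /= sr.
    * by move=> w r sr; apply: GL2; rewrite /= sr.
    * by move=> w r sr; apply: GA; rewrite /= sr.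
- elim: s p G GF GL1 GL2 GA => [|z s IH] [|p] G GF GL1 GL2 GA x //=.
  + by case: t => // _ /=; rewrite GA //; ring.
  + move=> [st]; rewrite GA // alt2_0 ?addr0; first ring.
    by move=> y w r sr; apply: ((GF y w).2 [::]); rewrite /=; lia.
  + move=> [st]; rewrite (altform_alt1 (GF z) (GL2 z)).2 ?st //.
    rewrite (IH p) ?st ?addr0 //.
    * by move=> w v; exact: altform_cons.
    * by move=> w r sr; apply: GL1; rewrite /= sr.
    * by move=> w r sr; apply: GL2; rewrite /= sr.
    * by move=> w r sr; apply: GA; rewrite /= sr.
Qed.

(** With [d] equal to [D X] this is the sum subtracted in [nabla_form]. [d] is an arbitrary map
    because [D X] is not linear over functions. *)
Fixpoint der (d : V -> V) F s : C :=
  if s is x :: s' then F (d x :: s') + der d (fun t => F (x :: t)) s' else 0.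

(** Moving [d x] to the front past the entries before [x] produces exactly the sign of pulling [x]
    out. *)
Lemma der_alt1 p d F s : altform p F -> size s = p ->
  der d F s = alt1 (fun x t => F (d x :: t)) s.
Proof.
elim: s p F => // x s IH [|p] F FF //= [ss].
rewrite (IH p) //; last exact: altform_cons.
congr (_ + _); rewrite -alt1N; apply: eq_alt1 => y t st.
by apply: (altform_swap (s := [::]) _ _ FF); rewrite /=; lia.
Qed.

Lemma derZ c d F s : der d (fun t => c * F t) s = c * der d F s.
Proof. by elim: s F => [|x s IH] F /=; rewrite ?IH; ring. Qed.

Lemma derD d F F' s : der d (fun t => F t + F' t) s = der d F s + der d F' s.
Proof. by elim: s F F' => [|x s IH] F F' /=; rewrite ?IH; ring. Qed.

Lemma eq_der d F F' s : (forall t, size t = size s -> F t = F' t) ->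
  der d F s = der d F' s.
Proof.
elim: s F F' => //= x s IH F F' E; congr (_ + _); first exact: E.
by apply: IH => t st; apply: E; rewrite /= st.
Qed.

Lemma der_0 d F s : (forall t, size t = size s -> F t = 0) -> der d F s = 0.
Proof.
move=> F0; rewrite (@eq_der _ _ (fun t => 0 * F t)) ?derZ ?mul0r //.
by move=> t /F0 ->; rewrite mul0r.
Qed.

(** The term in [c] arises when [d] hits the varied slot. For a connection [c] is the derivative of
    [f], and this term cancels the one from differentiating the product of [f] and the value of the
    form, so the covariant derivative of a form is tensorial. *)
Lemma der_leibniz p d F f c x y s t : altform p F ->
    (size s + size t).+1 = p -> d (f *: x + y) = c *: x + f *: d x + d y ->
  der d F (s ++ (f *: x + y) :: t) =
  c * F (s ++ x :: t) + f * der d F (s ++ x :: t) + der d F (s ++ y :: t).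
Proof.
move=> + + E; elim: s p F => [|z s IH] [|p] F FF // [st] /=.
  have FL := altform_head FF st.
  rewrite E -addrA !FL (@eq_der _ _ (fun r => f * F (x :: r) + F (y :: r))).
    by rewrite derD derZ; ring.
  by move=> r sr; rewrite (altform_head FF) // sr.
rewrite (FF.1 (d z :: s)) ?(IH p _ (altform_cons z FF)) //=; first by ring.
by rewrite -st addSn.
Qed.

(** The two terms where [d] hits one of the equal entries differ by a swap and cancel; all others
    still contain the repetition. *)
Lemma der_alternating p d F x s t : altform p F -> (size s + size t).+2 = p ->
  der d F (s ++ x :: x :: t) = 0.
Proof.
elim: s p F => [|z s IH] [|p] F FF // [st] /=.
  rewrite (altform_swap (s := [::]) _ _ FF) /=; last by rewrite -st.
  rewrite addrA addNr add0r der_0 // => r sr.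
  by apply: (FF.2 [::]); rewrite /= sr st.
rewrite (FF.2 (d z :: s)) /= ?addSn ?st // add0r.
by apply: IH (altform_cons z FF) _; rewrite -st addSn.
Qed.
End ListForms.

(** * Passing between indexed families and lists *)

Lemma codom_ordS T q (X : 'I_q.+1 -> T) :
  codom X = X ord0 :: codom (X \o lift ord0).
Proof. by rewrite /codom /image_mem enum_ordSl /= -map_comp. Qed.

Lemma codom_ord0 T (X : 'I_0 -> T) : codom X = [::].
Proof. by apply: size0nil; rewrite size_codom card_ord. Qed.

Lemma codom_nth T (x0 : T) q (s : seq T) : size s = q ->
  codom (fun k : 'I_q => nth x0 s k) = s.
Proof.
move=> ss; rewrite /codom /image_mem (map_comp (nth x0 s) val) val_enum_ord.
by rewrite -ss; exact: mkseq_nth.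
Qed.

Section IndexedSums.
Context {R : realType} {n : nat} {M : manifold R n}.
Local Notation C := (smooth_fun M).
Local Notation V := (vector_field M).

(** This and [omit_lift0] are the two branches of the recursion on lists: the head is pulled out, or
    it stays. *)
Lemma omit_ord0 q (X : 'I_q.+1 -> V) (I : seq 'I_q) :
  omit X (ord0 :: map (lift ord0) I) = omit (X \o lift ord0) I.
Proof.
rewrite /omit enum_ordSl /= (filter_map (lift ord0)) -(map_comp X).
congr map.
apply: eq_filter => k /=; rewrite inE eq_sym (negPf (neq_lift _ _)) /=.
by rewrite (mem_map lift_inj).
Qed.

Lemma omit_lift0 q (X : 'I_q.+1 -> V) (I : seq 'I_q) :
  omit X (map (lift ord0) I) = X ord0 :: omit (X \o lift ord0) I.
Proof.
have n0 : ord0 \notin map (lift ord0) I.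
  by apply/mapP => -[k _ /eqP]; rewrite (negPf (neq_lift _ _)).
rewrite /omit enum_ordSl /= n0 /= (filter_map (lift ord0)) -(map_comp X).
congr (_ :: map _ _).
by apply: eq_filter => k /=; rewrite (mem_map lift_inj).
Qed.

Lemma omit_nil q (X : 'I_q -> V) : omit X [::] = codom X.
Proof. by rewrite /omit filter_predT. Qed.

Lemma big_gt_ord0 q (F : 'I_q.+1 -> C) :
  \sum_(j < q.+1 | (@ord0 q < j)%N) F j = \sum_(j < q) F (lift ord0 j).
Proof. by rewrite big_mkcond big_ord_recl /= add0r. Qed.

Lemma big_gt_lift0 q (i : 'I_q) (F : 'I_q.+1 -> C) :
  \sum_(j < q.+1 | (lift ord0 i < j)%N) F j =
  \sum_(j < q | (i < j)%N) F (lift ord0 j).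
Proof. by rewrite big_mkcond big_ord_recl /= add0r -big_mkcond. Qed.

Lemma sum_alt1 q (X : 'I_q -> V) (G : V -> seq V -> C) :
  \sum_(i < q) (-1) ^+ (i.+1 + 1) * G (X i) (omit X [:: i]) = alt1 G (codom X).
Proof.
elim: q X G => [|q IH] X G.
  by rewrite big_ord0 codom_ord0.
rewrite big_ord_recl codom_ordS [RHS]/= -IH (omit_ord0 X [::]) omit_nil.
rewrite sqrrN expr1n mul1r -sumrN; congr (_ + _); apply: eq_bigr => i _.
by rewrite (omit_lift0 X [:: i]) !addn1 lift0 exprS mulN1r mulNr.
Qed.

(** The first two indices, 1 and 2, must have sign +, whence the extra 1 in the exponent; sums
    signed by (-1)^(i+j) are thus opposite to [alt2]. *)
Lemma sum_alt2 q (X : 'I_q -> V) (G : V -> V -> seq V -> C) :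
  \sum_(i < q) \sum_(j < q | (i < j)%N)
    (-1) ^+ (i.+1 + j.+1 + 1) * G (X i) (X j) (omit X [:: i; j]) =
  alt2 G (codom X).
Proof.
elim: q X G => [|q IH] X G.
  by rewrite big_ord0 codom_ord0.
rewrite big_ord_recl codom_ordS [RHS]/= -IH -sum_alt1 big_gt_ord0.
congr (_ + _); apply: eq_bigr => i _.
  rewrite (omit_ord0 X [:: i]) lift0; congr (_ * _).
  by rewrite !addSn !addnS !addn0 /= !exprS; ring.
rewrite big_gt_lift0; apply: eq_bigr => j _.
rewrite (omit_lift0 X [:: i; j]) !lift0; congr (_ * _).
by rewrite !addSn !addnS !exprS; ring.
Qed.

Lemma sum_alt3 q (X : 'I_q -> V) (G : V -> V -> V -> seq V -> C) :
  \sum_(i < q) \sum_(j < q | (i < j)%N) \sum_(k < q | (j < k)%N)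
    (-1) ^+ (i.+1 + j.+1 + k.+1) *
    G (X i) (X j) (X k) (omit X [:: i; j; k]) =
  alt3 G (codom X).
Proof.
elim: q X G => [|q IH] X G.
  by rewrite big_ord0 codom_ord0.
rewrite big_ord_recl codom_ordS [RHS]/= -IH -sum_alt2 big_gt_ord0 -sumrN.
congr (_ + _); apply: eq_bigr => i _; rewrite big_gt_lift0.
  apply: eq_bigr => j _; rewrite (omit_ord0 X [:: i; j]) !lift0.
  by congr (_ * _); rewrite !addSn !addnS !addn0 !exprS; ring.
rewrite -sumrN; apply: eq_bigr => j _; rewrite big_gt_lift0 -sumrN.
apply: eq_bigr => k _; rewrite (omit_lift0 X [:: i; j; k]) !lift0.
by rewrite !addSn !addnS !exprS; ring.
Qed.

(** Splitting [enum 'I_p] at an index exhibits that argument as one entry of the list; as the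
    enumeration has no repetitions, the update at [i] touches no other entry. *)
Lemma is_diff_form_codom p w (F : seq V -> C) :
  (forall X, w X = F (codom X)) -> altform p F -> is_diff_form (p := p) w.
Proof.
move=> wF FF; have se := size_enum_ord p; have ue := enum_uniq 'I_p.
split=> [X i f Y Y'|X i j ij Xij].
  rewrite !wF /codom /image_mem; move: (mem_enum 'I_p i) se ue.
  case/splitPr => r1 r2; rewrite size_cat /= addnS => se.
  rewrite cat_uniq /= negb_or => /and4P[_ /andP[ir1 _] ir2 _].
  have E y : map [eta X with i |-> y] (r1 ++ i :: r2) =
      map X r1 ++ y :: map X r2.
    rewrite map_cat /= eqxx; congr (_ ++ _ :: _); apply/eq_in_map => k kr /=;
      by case: eqP => // ki; rewrite -ki kr in ir1 ir2.
  by rewrite !E FF.1 // !size_map.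
rewrite wF /codom /image_mem; move: (mem_enum 'I_p i) (mem_enum 'I_p j) se.
case/splitPr => r1 r2; rewrite mem_cat inE eq_sym (negPf ij) /= => /orP[].
  case/splitPr => r3 r4 se; rewrite -catA map_cat /= map_cat /= Xij.
  rewrite (altform_repeat _ FF) //; move: se.
  by rewrite !size_map !size_cat /= ?size_cat /=; lia.
case/splitPr => r3 r4 se; rewrite map_cat /= map_cat /= Xij.
rewrite (altform_repeat _ FF) //; move: se.
by rewrite !size_map !size_cat /= ?size_cat /=; lia.
Qed.

Lemma altform_at_seq p (Theta : diff_form M p) : altform p (at_seq Theta).
Proof.
have [L A] := diff_formP Theta; split=> [s t st f x y|s t x st].
  have ip : (size s < p)%N by lia.
  (* The entry [y] at position [size s] is a placeholder, overwritten by every update. *)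
  pose X (k : 'I_p) := (s ++ y :: t)`_k.
  have E z : at_seq Theta (s ++ z :: t) = Theta [eta X with Ordinal ip |-> z].
    congr (Theta _); apply/funext => k /=; rewrite -val_eqE /= /X !nth_cat.
  by case: ltngtP => // ks; [rewrite -(subnSK ks) | rewrite ks subnn].
  by rewrite !E L.
have ip : (size s < p)%N by lia.
have jp : ((size s).+1 < p)%N by lia.
apply: (A _ (Ordinal ip) (Ordinal jp)); first by rewrite -val_eqE /=; lia.
by rewrite /= !nth_cat ltnn subnn ltnNge leqnSn subSnn.
Qed.
End IndexedSums.

(** * Vector fields, torsion and curvature *)

Section Geometry.
Context {R : realType} {n : nat} {M : manifold R n}.
Local Notation C := (smooth_fun M).
Local Notation V := (vector_field M).
Implicit Types (X Y Z : V) (f g : C).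

Lemma vector_field_eq X Y : (forall g, X g = Y g :> C) -> X = Y.
Proof. by move=> XY; apply/val_inj/funext. Qed.

Lemma vfD X f g : X (f + g) = (X f : C) + (X g : C) :> C.
Proof. by have /asboolP[_ + _] := vector_fieldP X; apply. Qed.

Lemma vfM X f g : X (f * g) = (X f : C) * g + f * (X g : C) :> C.
Proof. by have /asboolP[_ _ +] := vector_fieldP X; apply. Qed.

Lemma vf0 X : X 0 = 0 :> C.
Proof. by apply: (addrI (X 0 : C)); rewrite -vfD !addr0. Qed.

Lemma vfB X f g : X (f - g) = (X f : C) - (X g : C) :> C.
Proof. by apply: (addIr (X g : C)); rewrite -vfD !subrK. Qed.

Lemma vfZE f X g : (f *: X) g = f * (X g : C) :> C. Proof. by []. Qed.

Lemma vfDE X Y g : (X + Y) g = (X g : C) + (Y g : C) :> C. Proof. by []. Qed.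

Lemma vfNE X g : (- X) g = - (X g : C) :> C. Proof. by []. Qed.

Definition vfE := (vfZE, vfDE, vfNE).

Lemma vf_alt1 X G (s : seq V) :
  X (alt1 G s) = alt1 (fun Y t => X (G Y t) : C) s :> C.
Proof. by elim: s G => [|Y s IH] G /=; rewrite ?vf0 // vfB IH. Qed.

(** The term in [Y f] is the defect of linearity over functions that cancels the Leibniz terms in
    the torsion and in the curvature. The right-hand side is nested so that [nabla_linearl] applies
    to it twice. *)
Lemma lie_bracket_linearl f X X' Y :
  lie_bracket (f *: X + X') Y =
  f *: lie_bracket X Y + (- (Y f : C) *: X + lie_bracket X' Y).
Proof.
apply: vector_field_eq => g; rewrite !vfE.
change ((f * (X (Y g) : C) + (X' (Y g) : C) -
  (Y (f * (X g : C) + (X' g : C)) : C) : C) =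
  f * ((X (Y g) : C) - (Y (X g) : C)) + (- (Y f : C) * (X g : C) +
  ((X' (Y g) : C) - (Y (X' g) : C)))).
by rewrite vfD vfM; ring.
Qed.

Lemma lie_bracketC X Y : lie_bracket Y X = - lie_bracket X Y.
Proof. by apply: vector_field_eq => g; rewrite vfE; exact/esym/opprB. Qed.

Variable D : connection M.

Lemma nabla0l Y : D 0 Y = 0.
Proof.
apply: (addIr (D 0 Y)); rewrite -{1}[D 0 Y]scale1r -nabla_linearl.
by rewrite scaler0 !add0r.
Qed.

Lemma nablaNl X Y : D (- X) Y = - D X Y.
Proof.
by rewrite -[- X]addr0 -scaleN1r nabla_linearl nabla0l addr0 scaleN1r.
Qed.

Lemma torsionC X Y : torsion D Y X = - torsion D X Y.
Proof.
rewrite /torsion lie_bracketC.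
by apply: vector_field_eq => g; rewrite !vfE; ring.
Qed.

Lemma torsion_linearl f X X' Y :
  torsion D (f *: X + X') Y = f *: torsion D X Y + torsion D X' Y.
Proof.
rewrite /torsion lie_bracket_linearl nabla_linearl nabla_additiver.
rewrite nabla_leibniz.
by apply: vector_field_eq => g; rewrite !vfE; ring.
Qed.

Lemma torsion_linearr f X X' Y :
  torsion D Y (f *: X + X') = f *: torsion D Y X + torsion D Y X'.
Proof.
rewrite !(torsionC _ Y) torsion_linearl.
by apply: vector_field_eq => g; rewrite !vfE; ring.
Qed.

Lemma curvatureC X Y Z : curvature D Y X Z = - curvature D X Y Z.
Proof.
rewrite /curvature lie_bracketC nablaNl.
by apply: vector_field_eq => g; rewrite !vfE; ring.
Qed.

Lemma curvature_linearl f X X' Y Z :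
  curvature D (f *: X + X') Y Z = f *: curvature D X Y Z + curvature D X' Y Z.
Proof.
rewrite /curvature lie_bracket_linearl !nabla_linearl nabla_additiver.
rewrite nabla_leibniz.
by apply: vector_field_eq => g; rewrite !vfE; ring.
Qed.

Lemma curvature_linearr f X X' Y Z :
  curvature D Y (f *: X + X') Z = f *: curvature D Y X Z + curvature D Y X' Z.
Proof.
rewrite !(curvatureC _ Y) curvature_linearl.
by apply: vector_field_eq => g; rewrite !vfE; ring.
Qed.

Lemma sum_der (d : V -> V) (F : seq V -> C) s :
  \sum_(i < size s) F (set_nth 0 s i (d s`_i)) = der d F s.
Proof.
elim: s F => [|X s IH] F; first by rewrite big_ord0.
by rewrite big_ord_recl /= -IH.
Qed.

(** * The four forms written on lists, and their multilinearity and alternation *)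

Variables (p : nat) (Theta : diff_form M p) (Z : V).
Local Notation theta := (at_seq Theta).

Lemma nabla_form_at_seq X s : size s = p ->
  at_seq (nabla_form D X Theta) s = (X (theta s) : C) - der (D X) theta s.
Proof.
move=> ss; rewrite /at_seq /nabla_form -sum_der; congr (_ - _).
case: p / ss Theta => Th; apply: eq_bigr => i _; congr (Th _).
by apply/funext => k; rewrite /= nth_set_nth.
Qed.

Lemma altform_nabla X : altform p (at_seq (nabla_form D X Theta)).
Proof.
have TF := altform_at_seq Theta.
apply: eq_altform (@nabla_form_at_seq X) _; split=> [s t st f Y Y'|s t Y st].
  rewrite TF.1 // vfD vfM (der_leibniz (c := (X f : C)) TF st).
    ring.
  by rewrite nabla_additiver nabla_leibniz.
by rewrite TF.2 // vf0 (der_alternating _ _ TF) // subr0.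
Qed.

(** By [der_alt1] the correction terms are an alternating sum with [D X W] in front, which is linear
    in the direction [X]. *)
Lemma nabla_form_linear s : size s = p ->
  linear_map (fun X => at_seq (nabla_form D X Theta) s).
Proof.
have TF := altform_at_seq Theta.
move=> ss f X Y; rewrite !nabla_form_at_seq // !(der_alt1 _ TF ss).
rewrite (eq_alt1
  (G' := fun W t => f * theta (D X W :: t) + theta (D Y W :: t))).
  by rewrite alt1D alt1Z; rewrite !vfE; ring.
move=> W t st; rewrite nabla_linearl; case: p Theta TF ss => [|q] Th TF ss.
  by rewrite ss in st.
by rewrite (altform_head TF) //; apply: succn_inj; exact: etrans st ss.
Qed.

Definition omega_seq := alt1 (fun X t => theta (D X Z :: t)).

Lemma omegaE (X : 'I_p -> V) : omega D Theta Z X = omega_seq (codom X).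
Proof. exact: (sum_alt1 X (fun Y t => theta (D Y Z :: t))). Qed.

Lemma omega_at_seq s : size s = p -> at_seq (omega D Theta Z) s = omega_seq s.
Proof. by move=> ss; rewrite /at_seq omegaE codom_nth. Qed.

Lemma curvature_formE (X : 'I_p.+1 -> V) : curvature_form D Theta Z X =
  alt2 (fun Y W t => theta (curvature D Y W Z :: t)) (codom X).
Proof. exact: (sum_alt2 X (fun Y W t => theta (curvature D Y W Z :: t))). Qed.

(** The sign (-1)^(i+j) is opposite to that of [alt2]; exchanging the two terms of the difference
    absorbs it. *)
Lemma Psi_formE (X : 'I_p.+1 -> V) : Psi_form D Theta Z X =
  alt2 (fun Y W t => at_seq (nabla_form D W Theta) (D Y Z :: t) -
                     at_seq (nabla_form D Y Theta) (D W Z :: t)) (codom X).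
Proof.
rewrite -sum_alt2; apply: eq_bigr => i _; apply: eq_bigr => j _.
by rewrite addn1 exprS; ring.
Qed.

Definition torsion_term X Y W (t : seq V) : C :=
  theta [:: torsion D X Y, D W Z & t].

(** The cyclic sum over triples is the one in [alt2_alt1], with skew-symmetry coming from the
    torsion. In this shape the torsion form can be compared with the others pair by pair. *)
Lemma torsion_formE (X : 'I_p.+1 -> V) : torsion_form D Theta Z X =
  alt2 (fun Y W => alt1 (torsion_term Y W)) (codom X).
Proof.
rewrite alt2_alt1; first by rewrite -sum_alt3.
move=> Y W U t; rewrite size_codom card_ord => -[st].
have TF := altform_at_seq Theta; rewrite /torsion_term torsionC.
have FL : linear_map (fun Y => theta [:: Y, D U Z & t]).
  by apply: (TF.1 [::]); rewrite /= st.
exact: (linear_mapN _ FL).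
Qed.

Lemma theta_head_linear (h : V -> V) t :
    (size t).+1 = p -> (forall f X Y, h (f *: X + Y) = f *: h X + h Y) ->
  linear_map (fun X => theta (h X :: t)).
Proof.
move=> st hL f X Y; rewrite hL.
by apply: ((altform_at_seq Theta).1 [::]); rewrite /= add0n.
Qed.

Lemma altform_theta_cons q Y : p = q.+1 -> altform q (fun t => theta (Y :: t)).
Proof.
by move=> pq; apply: altform_cons; rewrite -pq; exact: altform_at_seq.
Qed.

Lemma omega_diff_form : is_diff_form (omega D Theta Z).
Proof.
apply: is_diff_form_codom omegaE _.
have [->|[q pq]] : p = 0 \/ exists q, p = q.+1 by case: (p) => [|q]; eauto.
  by split.
rewrite pq; apply: altform_alt1 => [X|t st]; first exact: altform_theta_cons.
by apply: theta_head_linear => [|f X Y]; rewrite ?pq ?st ?nabla_linearl.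
Qed.

(** [altform_alt2] starts in degree two. For [p = 0] the lists have length one, no pair can be
    pulled out and the sum is zero. *)
Lemma altform_alt2S (G : V -> V -> seq V -> C) :
    (forall q, p = q.+1 -> forall X Y, altform q (G X Y)) ->
    (forall Y t, (size t).+1 = p -> linear_map (fun X => G X Y t)) ->
    (forall X t, (size t).+1 = p -> linear_map (fun Y => G X Y t)) ->
    (forall X t, (size t).+1 = p -> G X X t = 0) ->
  altform p.+1 (alt2 G).
Proof.
move=> GF GL1 GL2 GA.
have [->|[q pq]] : p = 0 \/ exists q, p = q.+1 by case: (p) => [|q]; eauto.
  apply: (eq_altform (F' := fun=> 0)); last exact: altform0.
  by case=> [|X [|]] //= _; rewrite addr0.
rewrite pq; apply: altform_alt2 => *; first exact: GF.
- by apply: GL1; rewrite pq; congr _.+1.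
- by apply: GL2; rewrite pq; congr _.+1.
- by apply: GA; rewrite pq; congr _.+1.
Qed.

Lemma curvature_diff_form : is_diff_form (curvature_form D Theta Z).
Proof.
apply: is_diff_form_codom curvature_formE _; apply: altform_alt2S.
- by move=> q pq X Y; exact: altform_theta_cons.
- by move=> Y t st; apply: theta_head_linear => // *; exact: curvature_linearl.
- by move=> Y t st; apply: theta_head_linear => // *; exact: curvature_linearr.
- move=> X t st; rewrite (_ : curvature D X X Z = 0); last first.
    rewrite /curvature subrr sub0r (_ : lie_bracket X X = 0) ?nabla0l ?oppr0 //.
    by apply: vector_field_eq => g; exact: subrr.
  have := @theta_head_linear id t st (fun _ _ _ => erefl).
  by move/(linear_mapB 0 0); rewrite !subrr.
Qed.

Lemma Psi_diff_form : is_diff_form (Psi_form D Theta Z).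
Proof.
have Nhead X t : (size t).+1 = p ->
    linear_map (fun Y => at_seq (nabla_form D X Theta) (D Y Z :: t)).
  move=> st f Y Y'; rewrite nabla_linearl.
  by apply: ((altform_nabla X).1 [::]); rewrite /= add0n.
have Nform X t : (size t).+1 = p ->
    linear_map (fun Y => at_seq (nabla_form D Y Theta) (D X Z :: t)).
  by move=> st; apply: nabla_form_linear.
apply: is_diff_form_codom Psi_formE _; apply: altform_alt2S.
- move=> q pq X Y; apply: altformB.
  + by apply: altform_cons; rewrite -pq; exact: altform_nabla.
  + by apply: altform_cons; rewrite -pq; exact: altform_nabla.
- by move=> Y t st f X X'; rewrite Nhead // Nform //; ring.
- by move=> Y t st f X X'; rewrite Nhead // Nform //; ring.
- by move=> X t st; rewrite subrr.
Qed.

Lemma alt1_torsion_linear t : (size t).+1 = p ->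
  linear_map (fun X => alt1 (fun W r => theta [:: X, D W Z & r]) t).
Proof.
move=> st; apply: alt1_linear => W r sr.
by apply: (@theta_head_linear id) => //=; rewrite -st sr.
Qed.

Lemma torsion_diff_form : is_diff_form (torsion_form D Theta Z).
Proof.
apply: is_diff_form_codom torsion_formE _; apply: altform_alt2S.
- case=> [|q] pq X Y; first by split.
  apply: altform_alt1 => [W|t st].
    apply: (@altform_cons _ _ q (fun s => theta (torsion D X Y :: s))).
    exact: altform_theta_cons.
  move=> f W W'; rewrite /torsion_term nabla_linearl.
  by apply: ((altform_at_seq Theta).1 [:: _]); rewrite /= pq st.
- move=> Y t st f X X'; rewrite /torsion_term torsion_linearl.
  exact: alt1_torsion_linear.
- move=> X t st f Y Y'; rewrite /torsion_term torsion_linearr.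
  exact: alt1_torsion_linear.
- move=> X t st; rewrite /torsion_term (_ : torsion D X X = 0); last first.
    rewrite /torsion subrr sub0r (_ : lie_bracket X X = 0) ?oppr0 //.
    by apply: vector_field_eq => g; exact: subrr.
  by have /(linear_mapB 0 0) := alt1_torsion_linear st; rewrite !subrr.
Qed.

(** * The exterior derivative of omega *)

Lemma ext_dE (X : 'I_p.+1 -> V) :
  ext_d (omega D Theta Z) X =
  alt1 (fun Y t => (Y (omega_seq t) : C)) (codom X) -
  alt2 (fun Y W t => omega_seq (lie_bracket Y W :: t)) (codom X).
Proof.
rewrite /ext_d
  (sum_alt1 X (fun Y t => (Y (at_seq (omega D Theta Z) t) : C))).
congr (_ + _).
  apply: eq_alt1 => Y t; rewrite size_codom card_ord => -[st].
  by rewrite omega_at_seq.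
transitivity (- alt2 (fun Y W t =>
    at_seq (omega D Theta Z) (lie_bracket Y W :: t)) (codom X)).
  rewrite -sum_alt2 -sumrN; apply: eq_bigr => i _; rewrite -sumrN.
  by apply: eq_bigr => j _; rewrite [(_ + 1)%N]addn1 exprS mulN1r mulNr opprK.
congr (- _); apply: eq_alt2 => Y W t; rewrite size_codom card_ord => -[st].
by rewrite omega_at_seq //= -st.
Qed.

(** The part of omega at [X :: s] in which [Z] is differentiated along an entry of [s]. Being linear
    in [X], it merges the values at [D Y W], [D W Y] and the Lie bracket into the value at the
    torsion. *)
Let theta_nabla X := alt1 (fun W r => theta [:: X, D W Z & r]).

Lemma vf_omega_seq X s : size s = p ->
  X (omega_seq s) =
  alt1 (fun Y t => at_seq (nabla_form D X Theta) (D Y Z :: t) +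
                   theta (D X (D Y Z) :: t) + theta_nabla (D X Y) t) s :> C.
Proof.
move=> ss; have TF := altform_at_seq Theta.
rewrite /omega_seq vf_alt1 alt1D /theta_nabla.
transitivity (alt1 (fun Y t => at_seq (nabla_form D X Theta) (D Y Z :: t) +
    theta (D X (D Y Z) :: t)) s +
    alt1 (fun Y => alt1 (fun W t => theta [:: D Y Z, D X W & t])) s).
  rewrite -alt1D; apply: eq_alt1 => Y t st.
  have pt : p = (size t).+1 by rewrite st.
  rewrite nabla_form_at_seq //=
    (@der_alt1 _ _ (size t) (D X) (fun r => theta (D Y Z :: r))) //.
    by ring.
  exact: altform_theta_cons.
(* Exchanging the two pulled entries and swapping the first two arguments of [theta] give one sign
   each; the signs cancel. *)
congr (_ + _); rewrite alt1_alt1_swap -alt1N; apply: eq_alt1 => Y t st.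
rewrite -alt1N; apply: eq_alt1 => W r sr.
by rewrite (altform_swap (s := [::]) _ _ TF) ?opprK //= add0n sr st.
Qed.

Lemma omega_seq_cons X s : (size s).+1 = p ->
  omega_seq (X :: s) = theta (D X Z :: s) + theta_nabla X s.
Proof.
move=> ss; rewrite /omega_seq /theta_nabla /=; congr (_ + _); rewrite -alt1N.
apply: eq_alt1 => Y t st.
rewrite -(altform_swap (s := [::]) _ _ (altform_at_seq Theta)) //=.
by rewrite add0n st.
Qed.

Lemma ext_d_omega (X : 'I_p.+1 -> V) :
  ext_d (omega D Theta Z) X =
  curvature_form D Theta Z X - Psi_form D Theta Z X + torsion_form D Theta Z X.
Proof.
rewrite ext_dE curvature_formE Psi_formE torsion_formE.
rewrite (eq_alt1 (s := codom X) (G' := fun Y =>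
    alt1 (fun W t => at_seq (nabla_form D Y Theta) (D W Z :: t) +
                   theta (D Y (D W Z) :: t) + theta_nabla (D Y W) t)));
  last first.
  by move=> Y t; rewrite size_codom card_ord => -[st]; exact: vf_omega_seq.
(* The double [alt1] becomes an antisymmetrized [alt2], so the identity can be checked for a single
   pair [Y], [W] with remainder [t]. *)
rewrite alt1_alt1 -!alt2N -!alt2D; apply: eq_alt2 => Y W t.
rewrite size_codom card_ord => -[st]; rewrite omega_seq_cons //.
have FL := @theta_head_linear id t st (fun _ _ _ => erefl).
have HL : linear_map (theta_nabla ^~ t) := alt1_torsion_linear st.
rewrite /curvature !(linear_mapB _ _ FL).
rewrite -[alt1 _ t]/(theta_nabla (torsion D Y W) t).
rewrite /torsion !(linear_mapB _ _ HL).
by ring.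
Qed.
End Geometry.

Theorem theorem2p7 (R : realType) (n : nat) (M : manifold R n)
    (connM : connected [set: M]) (D : connection M)
    (p : nat) (Theta : diff_form M p) (Z : vector_field M) :
  [/\ is_diff_form (omega D Theta Z),
      is_diff_form (curvature_form D Theta Z),
      is_diff_form (Psi_form D Theta Z)
    & is_diff_form (torsion_form D Theta Z)] /\
  forall X : 'I_p.+1 -> vector_field M,
    ext_d (omega D Theta Z) X =
      curvature_form D Theta Z X - Psi_form D Theta Z X
      + torsion_form D Theta Z X.
Proof.
split; last by move=> X; exact: ext_d_omega.
split.
- exact: omega_diff_form.
- exact: curvature_diff_form.
- exact: Psi_diff_form.
- exact: torsion_diff_form.
Qed.
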